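(* Let $r\ge 2$ be an integer. Then for all integers $n\ge 2$, $$R_{1/r}(n)\ \le\ \frac{r(r+2)}{3r+2}\left(1+\frac1r\right)^{(r+1)n}-r.$$
   Context: For integers $r\ge1$, $n\ge 2$, the $n$-th $1/r$-Ramsey number $R_{1/r}(n)$ is the least $N$ such that every colouring of the edges of the complete graph $K_N$ with $r+1$ colours admits a copy of $K_n$ in $K_N$ whose edges use at most $r$ of the colours. *)

(* Defs.v *)
From mathcomp Require Import all_boot all_order all_algebra.

Set Implicit Arguments.
Unset Strict Implicit.
Unset Printing Implicit Defensive.

(* The edges of the complete graph on the vertex set S. *)
Definition Kedges (T : finType) (S : {set T}) : {set {set T}} :=
  [set e : {set T} | (e \subset S) && (#|e| == 2)].

(* An edge colouring of K_N is given by a function on all subsets of 'I_N;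
   only its values on the two-element subsets are ever used. *)
Definition colours_used (T C : finType) (c : {set T} -> C) (S : {set T}) :
  {set C} := c @: Kedges S.

Definition arrows (r n N : nat) : Prop :=
  forall c : {set 'I_N} -> 'I_r.+1,
  exists S : {set 'I_N}, #|S| = n /\ #|colours_used c S| <= r.

(* "N is R_{1/r}(n)": a predicate, since a number-valued function would need a
   proof that some N with the property exists. *)
Definition is_frac_ramsey (r n N : nat) : Prop :=
  arrows r n N /\ forall M : nat, arrows r n M -> N <= M.

(* Main.v *)
Require Import Defs.
From mathcomp Require Import all_boot all_order all_algebra.
From mathcomp Require Import zify ring lra.
Import Order.TTheory GRing.Theory Num.Theory.
Local Open Scope ring_scope.

(** Fix an (r+1)-colouring of the edges inside a vertex set [V] and targets
    [m i >= 2] such that no [m i]-subset of [V] avoids the colour [i].  For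
    [x] in [V], let [A i] be the set of the vertices joined to [x] by an edge of
    a colour other than [i]; it satisfies the hypothesis with [m i] lowered
    by 1, and since every other vertex lies in all but one of the [A i], the
    sizes [#|A i|] sum to [r (#|V| - 1)].  Hence [#|V| + r] grows by a factor of
    at most [1 + 1/r] per unit of [\sum_i m i].  The recursion is stopped as soon
    as some [m i = 2]: then [V] is monochromatic of colour [i], so that
    [#|V| < m j] for all [j != i].  Stopping at [m i = 1] would be easier, but
    its constant is too large when [r] is large. *)

Lemma bernoulli (R : numDomainType) (x : R) (n : nat) :
  0 <= x -> 1 + n%:R * x <= (1 + x) ^+ n.
Proof.
move=> x0; elim: n => [|n IHn]; first by rewrite mul0r addr0 expr0.
rewrite exprS; apply: (le_trans _ (ler_wpM2l _ IHn)); last by rewrite addr_ge0.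
rewrite -natr1 -subr_ge0.
have -> : (1 + x) * (1 + n%:R * x) - (1 + (n%:R + 1) * x) = n%:R * (x * x).
  by ring.
by rewrite !mulr_ge0.
Qed.

Lemma exists_subset_card (T : finType) (V : {set T}) (k : nat) :
  (k <= #|V|)%N -> exists2 S : {set T}, S \subset V & #|S| = k.
Proof.
case/card_geqP=> s [s_uniq s_size sV]; exists [set x in s].
  by apply/subsetP=> x; rewrite inE => /sV.
by rewrite cardsE (card_uniqP s_uniq).
Qed.

Lemma Kedges_card2 (T : finType) (e : {set T}) :
  #|e| = 2%N -> Kedges e = [set e].
Proof.
move=> e2; apply/setP=> f; rewrite !inE; apply/andP/eqP=> [[fe /eqP f2]|->].
  by apply/eqP; rewrite eqEcard fe f2 e2.
by rewrite e2.
Qed.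

(** An edge of colour [i] cannot contain [x], so it already lies in [S]. This is how [A i] inherits
    the hypothesis with [m i] lowered by 1. *)
Lemma colours_used_U1 (T C : finType) (c : {set T} -> C) (x : T)
    (S : {set T}) (i : C) :
  i \in colours_used c (x |: S) -> (forall y, y \in S -> c [set x; y] != i) ->
  i \in colours_used c S.
Proof.
case/imsetP=> e; rewrite inE => /andP[eS /cards2P[y [z [neq_yz def_e]]]] def_i.
move=> xS; apply/imsetP; exists e => //; rewrite inE.
move: eS; rewrite {}def_e in def_i *; rewrite cards2 neq_yz andbT.
rewrite !subUset !sub1set !in_setU1.
case/andP=> /predU1P[y_x|yS] /predU1P[z_x|zS].
- by rewrite y_x z_x eqxx in neq_yz.
- by move: (xS z zS); rewrite -y_x -def_i eqxx.
- by move: (xS y yS); rewrite -z_x setUC -def_i eqxx.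
- by rewrite yS zS.
Qed.

(** Double counting: each [y] in [W] is counted once for every colour other than [f y]. *)
Lemma sum_card_off_colour (T C : finType) (W : {set T}) (f : T -> C) :
  (\sum_i #|[set y in W | f y != i]| = #|C|.-1 * #|W|)%N.
Proof.
transitivity (\sum_i \sum_(y in W) (f y != i))%N.
  apply: eq_bigr => i _; rewrite -sum1_card big_mkcond [RHS]big_mkcond /=.
  by apply: eq_bigr => y _; rewrite inE; case: (y \in W) => //=; case: eqP.
rewrite exchange_big /= mulnC -sum_nat_const; apply: eq_bigr => y _.
rewrite -(cardC1 (f y)) -sum1_card [RHS]big_mkcond /=.
by apply: eq_bigr => i _; rewrite inE eq_sym; case: eqP.
Qed.

Lemma avoiding_bound_pair (r : nat) (T : finType)
    (c : {set T} -> 'I_r.+1) (V : {set T}) (m : 'I_r.+1 -> nat) (i : 'I_r.+1) :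
  m i = 2%N ->
  (forall j (S : {set T}), S \subset V -> #|S| = m j -> j \in colours_used c S) ->
  forall j, j != i -> (#|V| < m j)%N.
Proof.
move=> mi2 HV j neq_ji; rewrite ltnNge; apply/negP => /exists_subset_card[S SV Sm].
have /imsetP[e] := HV j S SV Sm.
rewrite inE => /andP[eS /eqP e2] def_j.
have := HV i e (subset_trans eS SV); rewrite e2 mi2 => /(_ erefl).
by rewrite /colours_used Kedges_card2 // imset_set1 inE -def_j eq_sym (negPf neq_ji).
Qed.

Lemma avoiding_bound (R : realFieldType) (r : nat) (T : finType)
    (c : {set T} -> 'I_r.+1) (V : {set T}) (m : 'I_r.+1 -> nat) :
  (0 < r)%N -> (forall i, 1 < m i)%N ->
  (forall i (S : {set T}), S \subset V -> #|S| = m i -> i \in colours_used c S) ->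
  (#|V|%:R + r%:R) * (1 + r%:R^-1) ^+ r.*2.+1
    <= r%:R * (1 + r%:R^-1) ^+ (\sum_i m i) :> R.
Proof.
move=> r0; set b := 1 + _.
have r0R : 0 < r%:R :> R by rewrite ltr0n.
have b1 : 1 < b by rewrite ltrDl invr_gt0.
have b0 : 0 < b by apply: lt_trans b1.
have rb : r%:R * b = r%:R + 1 by rewrite /b mulrDr mulr1 divff ?gt_eqF.
have [k] := ubnP #|V|; elim: k V m => // k IHk V m /ltnSE leVk m2 HV.
have [V0 | [x xV]] := set_0Vmem V.
  rewrite V0 cards0 add0r ler_pM2l // ler_eXn2l //.
  have : (\sum_(i < r.+1) 2 <= \sum_i m i)%N by apply: leq_sum.
  by rewrite sum_nat_const card_ord; lia.
have [i /eqP mi2 | m3] := pickP (fun i => m i == 2%N).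
  have ltVm := avoiding_bound_pair _ _ _ _ _ _ mi2 HV.
  have V1 : (0 < #|V|)%N by apply/card_gt0P; exists x.
  case def_v: #|V| V1 ltVm => [|v] // _ ltVm.
  (* The other [r] targets are at least [v + 2], so the sum is at least [2 + r(v + 2)]. Bernoulli on
     the excess over [2r + 1] then suffices; it is tight for [v = 0], which dictates the exponent
     [2r + 1]. *)
  have le_s : (r.*2.+1 + (r * v).+1 <= \sum_i m i)%N.
    rewrite (bigD1 i) //= mi2.
    have : (\sum_(j | j != i) v.+2 <= \sum_(j | j != i) m j)%N by exact: leq_sum.
    rewrite sum_nat_const.
    have -> : #|[pred j | j != i]| = r by rewrite cardC1 card_ord.
    by move: (\sum_(j | _) m j)%N => s; nia.
  apply: (@le_trans _ _ (r%:R * b ^+ (r.*2.+1 + (r * v).+1))); last first.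
    by rewrite ler_pM2l // ler_eXn2l.
  rewrite exprD mulrCA mulrC ler_pM2l ?exprn_gt0 //.
  apply: (@le_trans _ _ (r%:R * (1 + (r * v).+1%:R * r%:R^-1))); last first.
    by rewrite ler_pM2l // bernoulli // invr_ge0 ltW.
  rewrite -!natr1 natrM mulrDr mulr1 mulrCA divff ?gt_eqF // mulr1.
  have : v%:R <= r%:R * v%:R :> R by rewrite ler_peMl ?ler0n // ler1n.
  by lra.
pose W := V :\ x; pose A i := [set y in W | c [set x; y] != i].
have cardV : #|V| = #|W|.+1 by rewrite (cardsD1 x) xV.
have AW i : A i \subset W by apply/subsetP=> y; rewrite inE => /andP[].
have HA i : (#|A i|%:R + r%:R) * b ^+ r.*2.+1 * b
    <= r%:R * b ^+ (\sum_i m i).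
  have m'2 j : (1 < m j - (j == i))%N.
    by have := m2 j; have /negbT := m3 j; case: eqP; lia.
  have -> : (\sum_j m j = (\sum_j (m j - (j == i))).+1)%N.
    rewrite (bigD1 i) //= [in RHS](bigD1 i) //= eqxx.
    rewrite -addSn; congr (_ + _)%N; first by have := m2 i; lia.
    by apply: eq_bigr => j /negPf ->; rewrite subn0.
  rewrite [X in _ <= _ * X]exprSr mulrA ler_pM2r //; apply: IHk => //.
    by apply: leq_ltn_trans (subset_leq_card (AW i)) _; rewrite -cardV.
  move=> j S SA; have SW := subset_trans SA (AW i).
  have SV := subset_trans SW (subD1set V x).
  case: eqP => [->|_]; rewrite ?subn0; last exact: HV.
  move=> cardS; apply: (@colours_used_U1 _ _ _ x); last first.
    by move=> y /(subsetP SA); rewrite inE => /andP[].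
  apply: HV; first by rewrite subUset sub1set xV.
  rewrite cardsU1 cardS; have := subsetP SW x; rewrite !inE eqxx /=.
  by case: (x \in S) => [/(_ isT)//|_]; rewrite addnC subnK // ltnW.
(* Summed over the [r + 1] colours, the left side has the factor [r(#|W| + r + 1) = r(#|V| + r)];
   since [r * b = r + 1], the factor [r + 1] cancels. *)
have := ler_sum (index_enum _) (P := predT) (fun i _ => HA i).
rewrite -!mulr_suml big_split /= -natr_sum sum_card_off_colour.
rewrite !sumr_const card_ord /= natrM -[r%:R *+ _]mulr_natr.
rewrite -natr1 cardV -natr1.
move: (b ^+ _) (b ^+ _) => B s HB.
rewrite -(ler_pM2r (_ : 0 < r%:R + 1)); last by rewrite addr_gt0.
rewrite [leRHS]mulrAC; apply: le_trans HB; rewrite -[in leLHS]rb.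
by rewrite le_eqVlt; apply/orP; left; apply/eqP; ring.
Qed.

(** Taking colourings as finite functions makes [arrows] decidable: its failure yields a bad
    colouring, and a least [N] can be selected. *)
Definition arrowsb (r n N : nat) : bool :=
  [forall c : {ffun {set 'I_N} -> 'I_r.+1},
    exists S : {set 'I_N}, (#|S| == n) && (#|colours_used c S| <= r)%N].

Lemma arrowsP (r n N : nat) : reflect (arrows r n N) (arrowsb r n N).
Proof.
apply: (iffP forallP) => arr c.
  have /existsP[S /andP[/eqP Sn Sr]] := arr (finfun c); exists S; split=> //.
  suff <- : colours_used (finfun c) S = colours_used c S by [].
  by apply: eq_imset => e; rewrite ffunE.
by have [S [Sn Sr]] := arr c; apply/existsP; exists S; rewrite Sn eqxx.
Qed.

(** In a bad colouring every [n]-subset sees all [r + 1] colours, so [avoiding_bound] applies to the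
    whole vertex set with all targets equal to [n]. *)
Lemma not_arrows_bound (R : realFieldType) (r n N : nat) :
  (0 < r)%N -> (1 < n)%N -> ~ arrows r n N ->
  (N%:R + r%:R) * (1 + r%:R^-1) ^+ r.*2.+1
    <= r%:R * (1 + r%:R^-1) ^+ (r.+1 * n) :> R.
Proof.
move=> r0 n1 /arrowsP; rewrite negb_forall => /existsP[c].
rewrite negb_exists => /forallP noS.
have := avoiding_bound R r _ c setT (fun _ => n) r0 (fun _ => n1).
rewrite cardsT card_ord sum_nat_const card_ord; apply=> i S _ Sn.
have := noS S; rewrite Sn eqxx /= -ltnNge => full.
suff -> : colours_used c S = setT by rewrite inE.
by apply/eqP; rewrite eqEcard subsetT cardsT card_ord.
Qed.

(* [(1 + 1/r) ^ (2r+1) >= (3r+1)/r] by Bernoulli, and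
   [r/(3r+1) < (r+2)/(3r+2)]; the gap absorbs the [+ 1]. *)
Lemma ramsey_constant (R : realFieldType) (r s : nat) (v : R) :
  (0 < r)%N -> (r.*2 <= s)%N ->
  (v + r%:R) * (1 + r%:R^-1) ^+ r.*2.+1 <= r%:R * (1 + r%:R^-1) ^+ s ->
  v + 1 <= (r%:R * (r%:R + 2)) / (3 * r%:R + 2) * (1 + 1 / r%:R) ^+ s - r%:R.
Proof.
move=> r0 le_s; rewrite div1r.
have x0 : 0 < r%:R :> R by rewrite ltr0n.
have y0 : 0 <= r%:R^-1 :> R by rewrite invr_ge0 ltW.
have := bernoulli R _ r.*2.+1 y0; have := bernoulli R _ s y0.
move: (_ ^+ s) (_ ^+ r.*2.+1) => X B HX HB H.
have r1 : 1 <= r%:R :> R by rewrite ler1n.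
have rX : 3 * r%:R <= r%:R * X.
  apply: le_trans (ler_wpM2l (ltW x0) HX).
  rewrite mulrDr mulr1 mulrCA divff ?gt_eqF // mulr1.
  have : (r.*2%:R : R) <= s%:R by rewrite ler_nat.
  by rewrite -muln2 natrM; lra.
have rB : 3 * r%:R + 1 <= r%:R * B.
  apply: le_trans (ler_wpM2l (ltW x0) HB).
  rewrite mulrDr mulr1 mulrCA divff ?gt_eqF // mulr1.
  have -> : r.*2.+1 = (2 * r + 1)%N by lia.
  by rewrite natrD natrM; lra.
have Hv : (v + r%:R) * (3 * r%:R + 1) <= r%:R * (r%:R * X).
  have [v0|v0] := lerP 0 (v + r%:R); last by nra.
  apply: le_trans (ler_wpM2l v0 rB) _.
  by rewrite mulrCA ler_pM2l.
rewrite lerBrDr mulrAC ler_pdivlMr; last by lra.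
rewrite -(ler_pM2r (_ : 0 < 3 * r%:R + 1)); last by lra.
move: (r%:R * X) rX Hv (mulrAC r%:R (r%:R + 2) X) => Y rX Hv ->.
move: (r%:R) x0 r1 Y rX Hv => x x0 r1 Y rX Hv.
(* As [(x + 2)(3x + 1) - x(3x + 2) = 5x + 2], what remains is [(3x + 1)(3x + 2) <= (5x + 2)Y], which
   follows from [Y >= 3x] and [x >= 1]. *)
have : (v + x) * (3 * x + 1) * (3 * x + 2) <= x * Y * (3 * x + 2).
  by rewrite ler_wpM2r //; lra.
have : 3 * x * (5 * x + 2) <= Y * (5 * x + 2) by rewrite ler_wpM2r //; lra.
by nra.
Qed.

Theorem theorem1p2 (r : nat) (hr : (2 <= r)%N) (n : nat) (hn : (2 <= n)%N) :
  exists N : nat, is_frac_ramsey r n N /\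
    (N%:R : rat) <=
      (r%:R * (r%:R + 2)) / (3 * r%:R + 2) * (1 + 1 / r%:R) ^+ (r.+1 * n)
      - r%:R.
Proof.
have r0 : (0 < r)%N by apply: ltnW.
set rhs := _ - r%:R.
have bound N : ~ arrows r n N -> (N.+1%:R : rat) <= rhs.
  move=> /(not_arrows_bound rat r n N r0 hn) H.
  by rewrite -natr1; apply: ramsey_constant H => //; nia.
have arrow_ex : exists N, arrowsb r n N.
  (* A failure at a number above [rhs] would contradict [bound]. *)
  exists (Num.bound `|rhs|); apply/negPn/negP => /arrowsP/bound.
  rewrite leNgt => /negP; apply; apply: le_lt_trans (ler_norm _) _.
  by apply: lt_trans (archi_boundP _) _; rewrite ?normr_ge0 ?ltr_nat.
case: (ex_minnP arrow_ex) => N arrN minN; exists N; split.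
  by split; [apply/arrowsP | move=> M /arrowsP/minN].
(* [bound] is applied to the predecessor of [N], which fails by minimality; [N = 0] is excluded
   because an empty vertex set has no [n]-subset. *)
case: N arrN minN => [/arrowsP arr0 _|N _ minN].
  have [S [Sn _]] := arr0 (fun=> ord0).
  by have := subset_leq_card (subsetT S); rewrite Sn cardsT card_ord leqNgt ltnW.
by apply: bound => /arrowsP/minN; rewrite ltnn.
Qed.
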